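(* For all smooth $f \colon [0,\infty) \to \mathbb{R}$ with $f(0)=0$, it holds that $$ \log \int_0^\infty e^{|f(x)|} e^{-\frac{x^2}{2}} dx \leq \int_0^\infty \frac{e^{|f'(x)|^2/2}}{\sqrt{1+\frac{|f'(x)|^2}{2}}}\, e^{-\frac{x^2}{2}} dx + 5.14 . $$
   Context: The right-hand side may be $+\infty$, in which case the inequality is trivial. *)

(* Defs.v *)
From HB Require Import structures.
From mathcomp Require Import all_boot all_order all_algebra.
From mathcomp Require Import all_classical all_reals all_analysis.

Set Implicit Arguments.
Unset Strict Implicit.
Unset Printing Implicit Defensive.

Import Order.TTheory GRing.Theory Num.Theory.
Import numFieldNormedType.Exports.

Local Open Scope classical_set_scope.
Local Open Scope ring_scope.

(* A function on a set D is represented by a total function R -> R of which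
   only the values on D matter: the difference quotients at x \in D use
   points of D only, so that the derivative is one-sided at an endpoint of
   D (the library's derive1 would be two-sided there). *)
Definition diff_quot {R : realType} (f : R -> R) (x : R) : R -> R :=
  fun y => (f y - f x) / (y - x).

Definition derivable_in {R : realType} (D : set R) (f : R -> R) (x : R) : Prop :=
  cvg (diff_quot f x y @[y --> within D x^']).

Definition derive_in {R : realType} (D : set R) (f : R -> R) (x : R) : R :=
  lim (diff_quot f x y @[y --> within D x^']).

(* Intended for D without isolated points: at an isolated point the filter
   of punctured neighbourhoods within D is improper. *)
Definition smooth_in {R : realType} (D : set R) (f : R -> R) : Prop :=
  forall (n : nat) (x : R), D x -> derivable_in D (iter n (derive_in D) f) x.

(* Main.v *)
(* Write k(x) = (9/8) / (16 + x) and let J be the integral on the right.  For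
   every slope g and every x >= 0,
     g - x + k(x) <= e^(g^2/2) / sqrt(1 + g^2/2) * e^(-x^2/2);
   for large x the worst g is about x - log(sqrt 2) / x, and it leaves room for
   any k(x) ~ a / x with a < 1 + log(sqrt 2) = 1.34...; the exponent a = 9/8 > 1
   makes exp(- int k) integrable.  Integrating along f, and along - f, gives
     |f(x)| - x^2/2 <= J - (9/8) ln(1 + x/16),
   so that the integral on the left is at most 128 e^J, and ln 128 <= 5.14. *)
Require Import Defs.
From HB Require Import structures.
From mathcomp Require Import all_boot all_order all_algebra.
From mathcomp Require Import all_classical all_reals all_analysis.
From mathcomp Require Import measurable_realfun ring lra.
Import Order.TTheory GRing.Theory Num.Theory.
Import numFieldNormedType.Exports.
Local Open Scope classical_set_scope.
Local Open Scope ring_scope.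

(** * Pointwise bound of slope plus correction by the cost *)

(* [m z <= e^(m z - 1)] trades the linear left-hand side for an exponential;
   [m] is a free parameter, to be taken close to the optimal slope. *)
Lemma le_expR_div_sqrt {R : realType} (m z y p : R) : 0 < m -> 0 < p ->
  p <= m ^+ 2 * expR (2 * (y + 1 - m * z)) -> z <= expR y / Num.sqrt p.
Proof.
move=> m0 p0; rewrite expRM_natl -exprMn => pm.
have sp : Num.sqrt p <= m * expR (y + 1 - m * z).
  have m1 : 0 <= m * expR (y + 1 - m * z) by rewrite mulr_ge0 ?expR_ge0 ?ltW.
  by rewrite -(ger0_norm m1) -sqrtr_sqr ler_wsqrtr.
have e1 : m * z <= expR (m * z - 1) by have := expR_ge1Dx (m * z - 1); lra.
rewrite ler_pdivlMr ?sqrtr_gt0//.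
have [z0|z0] := leP z 0.
  by apply: le_trans (expR_ge0 y); rewrite mulr_le0_ge0 ?sqrtr_ge0.
apply: (le_trans (ler_wpM2l (ltW z0) sp)).
rewrite mulrCA mulrA.
apply: (le_trans (ler_wpM2r (expR_ge0 _) e1)).
by rewrite -expRD ler_expR; lra.
Qed.

(** The case [m = 1]. The exponent equals [(g - 1)^2 + 1 + (2 x - x^2) - 2 k], and [2 x - x^2 >= 0]
    on [0, 1]. Using [e^t >= 1 + t] on each factor reduces the claim to a quadratic inequality in
    [g]. *)
Lemma speed_bound_le1 {R : realType} (x g k : R) : 0 <= x <= 1 -> 0 <= k <= 1 / 10 ->
  1 + g ^+ 2 / 2 <= expR (2 * ((g ^+ 2 - x ^+ 2) / 2 + 1 - (g - x + k))).
Proof.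
move=> /andP[x0 x1] /andP[k0 k1].
have h : (g - 1) ^+ 2 + 2 * (1 / 2 - k) <=
    2 * ((g ^+ 2 - x ^+ 2) / 2 + 1 - (g - x + k)) by nra.
have e1 : 1 + (g - 1) ^+ 2 <= expR ((g - 1) ^+ 2) by exact: expR_ge1Dx.
have e2 : 14 / 10 <= expR (1 / 2 - k) by have := expR_ge1Dx (1 / 2 - k); lra.
apply: le_trans (_ : expR ((g - 1) ^+ 2 + 2 * (1 / 2 - k)) <= _); last by rewrite ler_expR.
rewrite expRD expRM_natl.
set a := expR _ in e1 *; set b := expR _ in e2 *.
have b2 : 19 / 10 <= b ^+ 2 by nra.
have : 19 / 10 * (1 + (g - 1) ^+ 2) <= a * b ^+ 2.
  by rewrite mulrC; apply: ler_pM => //; have := sqr_ge0 (g - 1); lra.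
(* 19/14 minimizes the quadratic [19/10 * (1 + (g - 1)^2) - (1 + g^2 / 2)], whose minimum is
   positive. *)
apply: le_trans; have := sqr_ge0 (g - 19 / 14); nra.
Qed.

(** The case [m = x]. Completing the square in [w = g - x] turns the exponent into [w^2 + r] with
    [r = 2 - (9/4) x / (16 + x)], and [e^t >= 1 + t] is applied to both terms. *)
Lemma speed_bound_ge1 {R : realType} (x g : R) : 1 <= x ->
  1 + g ^+ 2 / 2 <= x ^+ 2 *
    expR (2 * ((g ^+ 2 - x ^+ 2) / 2 + 1 - x * (g - x + 9 / 8 / (16 + x)))).
Proof.
move=> x1; set w := g - x.
have -> : 2 * ((g ^+ 2 - x ^+ 2) / 2 + 1 - x * (g - x + 9 / 8 / (16 + x)))
   = w ^+ 2 + (2 - 9 / 4 * x / (16 + x)) by rewrite /w; field; lra.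
have gE : g = x + w by rewrite /w; ring.
have xk0 : 0 <= x / (16 + x) by apply: divr_ge0; lra.
rewrite expRD.
have e1 : 1 + w ^+ 2 <= expR (w ^+ 2) by exact: expR_ge1Dx.
set r := 2 - _.
have e2 : 1 + r <= expR r by exact: expR_ge1Dx.
set a := expR _ in e1 *; set b := expR _ in e2 *.
have w2 : 0 <= w ^+ 2 by exact: sqr_ge0.
(* For small [x] the factor [1 + r] is large enough to absorb a crude bound on [(x + w)^2]. For
   large [x] only [1 + r >= 3/4] is left, still above the leading coefficient 1/2 of [g^2 / 2], and
   [x^2 >= 16] absorbs the other terms. *)
have [x4|x4] := leP x 4.
- have rb : 5 / 2 <= 1 + r.
    have : x / (16 + x) <= 1 / 5 by rewrite ler_pdivrMr; lra.
    rewrite /r -mulrA; lra.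
  have ab : 5 / 2 * (1 + w ^+ 2) <= a * b by nra.
  have : x ^+ 2 * (5 / 2 * (1 + w ^+ 2)) <= x ^+ 2 * (a * b).
    by apply: ler_wpM2l => //; exact: sqr_ge0.
  apply: le_trans.
  have x2 : 1 <= x ^+ 2 by nra.
  have : (x + w) ^+ 2 <= 2 * (x ^+ 2 + w ^+ 2) by have := sqr_ge0 (x - w); nra.
  rewrite -gE; nra.
- have rb : 3 / 4 <= 1 + r.
    have : x / (16 + x) <= 1 by rewrite ler_pdivrMr; lra.
    rewrite /r -mulrA; lra.
  have ab : 3 / 4 * (1 + w ^+ 2) <= a * b by nra.
  have : x ^+ 2 * (3 / 4 * (1 + w ^+ 2)) <= x ^+ 2 * (a * b).
    by apply: ler_wpM2l => //; exact: sqr_ge0.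
  apply: le_trans.
  have x2 : 16 <= x ^+ 2 by nra.
  have : x * w <= x ^+ 2 * w ^+ 2 / 8 + 2 by have := sqr_ge0 (x * w - 4); nra.
  rewrite gE; nra.
Qed.

Lemma speed_bound {R : realType} (x g : R) : 0 <= x ->
  g - x + 9 / 8 / (16 + x) <=
  expR (g ^+ 2 / 2) / Num.sqrt (1 + g ^+ 2 / 2) * expR (- (x ^+ 2 / 2)).
Proof.
move=> x0; rewrite [leRHS]mulrAC -expRD.
have p0 : 0 < 1 + g ^+ 2 / 2 by have := sqr_ge0 g; lra.
have E : g ^+ 2 / 2 + - (x ^+ 2 / 2) = (g ^+ 2 - x ^+ 2) / 2 by field.
(* The worst slope is close to [x] for large [x], hence [m = x]; near 0 that choice degenerates,
   since [m^2] would vanish while [p >= 1]. *)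
have [x1|x1] := leP x 1.
- apply: (@le_expR_div_sqrt _ 1) => //; rewrite expr1n !mul1r E.
  apply: speed_bound_le1; first by rewrite x0.
  by rewrite divr_ge0 ?ler_pdivrMr/=; lra.
- by apply: (@le_expR_div_sqrt _ x) => //; [lra|rewrite E; apply: speed_bound_ge1; lra].
Qed.

(** * From one-sided derivatives to functions on the line *)

(* Multiply the difference quotient by [y - x], which tends to 0. *)
Lemma derivable_in_cvg {R : realType} (D : set R) (f : R -> R) (x : R) :
  derivable_in D f x -> f y @[y --> within D (nbhs x)] --> f x.
Proof.
move=> cf.
have h : (diff_quot f x y * (y - x) + f x) @[y --> within D x^'] --> f x.
  rewrite -[X in _ --> X]add0r -(mulr0 (lim (diff_quot f x y @[y --> within D x^']))).
  apply: cvgD; last exact: cvg_cst.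
  apply: cvgM => //.
  rewrite -(subrr x); apply: cvgB; last exact: cvg_cst.
  apply: cvg_within_filter; apply: cvg_within_filter; exact: cvg_id.
move=> A Ax; have := h _ Ax; rewrite /nbhs/= /within/= /nbhs/= => hA.
near=> y => Dy.
have [->|yx] := eqVneq y x; first exact: nbhs_singleton.
have : y != x -> D y -> A (diff_quot f x y * (y - x) + f x).
  by near: y; exact: hA.
by move=> /(_ yx Dy); rewrite /diff_quot divfK ?subr_eq0// subrK.
Unshelve. all: end_near. Qed.

(* Precomposition with [max x 0] turns one-sided regularity on [0, +oo[ into
   regularity on the whole line, where the library's integration lemmas apply. *)
Lemma continuous_comp_max {R : realType} (f : R -> R) :
  (forall x : R, 0 <= x -> f y @[y --> within `[0%R, +oo[ (nbhs x)] --> f x) ->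
  continuous (fun x : R => f (Num.max x 0)).
Proof.
move=> cf x A Ax.
have mx : 0 <= Num.max x 0 by rewrite le_max lexx orbT.
have := cf _ mx _ Ax; rewrite /nbhs/= /within/= => hA.
have : (Num.max y 0 : R) @[y --> x] --> (Num.max x 0 : R).
  exact: (@continuous_max _ _ (fun y : R => y) (fun=> 0) x cvg_id (cvg_cst _)).
move=> /(_ _ hA) h; apply: (@filterS _ (nbhs x) _ _ _ _ h) => y /=; apply.
by rewrite in_itv/= le_max lexx orbT.
Qed.

Lemma derivable_in_is_derive {R : realType} (f : R -> R) (x : R) : 0 < x ->
  derivable_in `[0, +oo[ f x ->
  is_derive x 1 (fun x : R => f (Num.max x 0)) (derive_in `[0, +oo[ f x).
Proof.
move=> x0 cf.
have shift : (h + x) @[h --> (0 : R)] --> x.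
  by rewrite -[X in _ --> X]add0r; apply: cvgD; [exact: cvg_id|exact: cvg_cst].
have shift_gt0 : \forall h \near (0 : R), 0 < h + x.
  by apply: (shift [set y | 0 < y]); exact: lt_nbhsr.
(* As [x > 0], small translations stay in the half-line, so the restriction to it disappears from
   the limit. *)
have punctured_shift : (h + x) @[h --> 0^'] --> within `[0, +oo[ x^'.
  move=> A; rewrite /nbhs/= /within/= => /shift hA.
  near=> h.
  have h0 : h != 0 by near: h; exact: nbhs_dnbhs_neq.
  have : h + x != x -> (`[0, +oo[%classic : set R) (h + x) -> A (h + x).
    by near: h; apply: nbhs_dnbhs; exact: hA.
  move=> hA'; refine (hA' _ _); first by rewrite -subr_eq0 addrK.
  by rewrite /= in_itv/= andbT ltW//; near: h; apply: nbhs_dnbhs.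
have h : h^-1 *: (f (Num.max (h *: 1 + x) 0) - f (Num.max x 0)) @[h --> 0^'] -->
    derive_in `[0, +oo[ f x.
  have := @cvg_comp _ _ _ (fun h => h + x) (diff_quot f x) _ _ _ punctured_shift cf.
  apply: cvg_trans; apply: near_eq_cvg.
  near=> h => /=.
  have hx0 : 0 < h + x by near: h; apply: nbhs_dnbhs.
  by rewrite /diff_quot addrK /GRing.scale/= mulr1 !max_l ?ltW// mulrC.
apply: DeriveDef; first by apply/cvg_ex; exists (derive_in `[0, +oo[ f x); exact: h.
exact: cvg_lim h.
Unshelve. all: end_near. Qed.

(** * The logarithmic correction and its integral *)

(** The antiderivative of [1 / (16 + x)] vanishing at 0. It is smooth on a neighbourhood of [0,
    +oo[, so the endpoint 0 can be treated as an interior point. *)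
Definition log_gain {R : realType} (x : R) := ln (1 + x / 16).

Lemma is_derive_log_gain {R : realType} (x : R) :
  -16 < x -> is_derive x 1 log_gain (16 + x)^-1.
Proof.
move=> x0.
have h : is_derive x 1 (fun y : R => 1 + y / 16) 16^-1.
  by apply: is_derive_eq; rewrite /GRing.scale/= ?mulr1 ?mulr0 ?add0r ?addr0 div1r.
have p : 0 < 1 + x / 16 by lra.
have := @is_derive1_comp _ _ (fun y : R => 1 + y / 16) _ _ _ (is_derive1_ln p) h.
by move=> /is_derive_eq; apply; field; apply: lt0r_neq0; lra.
Qed.

Lemma is_derive_expR_log_gain {R : realType} (c x : R) : -16 < x ->
  is_derive x 1 (fun y => expR (c * log_gain y)) (c * (16 + x)^-1 * expR (c * log_gain x)).
Proof.
move=> x0; have hl := is_derive_log_gain x x0.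
have h : is_derive x 1 (fun y => c * log_gain y) (c * (16 + x)^-1).
  by apply: is_derive_eq; rewrite /GRing.scale/= ?mulr1 ?mulr0 ?add0r ?addr0.
have := @is_derive1_comp _ _ (fun y : R => c * log_gain y) _ _ _
  (is_derive_expR (c * log_gain x)) h.
by move=> /is_derive_eq; apply; rewrite mulrC.
Qed.

Lemma log_gain_cvgy (R : realType) : @log_gain R x @[x --> +oo] --> +oo.
Proof.
apply/cvgryPge => M; near=> x.
have xM : 16 * expR M <= x by near: x; apply: nbhs_pinfty_ge; exact: num_real.
have p := expR_gt0 M.
by rewrite -ler_expR lnK ?posrE; lra.
Unshelve. all: end_near. Qed.

Lemma integral_expR_log_gain (R : realType) :
  (\int[@lebesgue_measure R]_(x in `[0%R, +oo[)
     (expR (- (9 / 8) * log_gain x))%:E = 128%:E)%E.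
Proof.
(* The integrand is [(1 + x/16)^(-9/8)], with antiderivative [-128 (1 + x/16)^(-1/8)], where 128 =
   16 * 8; it tends to 0 at infinity. *)
pose F x : R := - 128 * expR (- (1 / 8) * log_gain x).
have dF (x : R) : -16 < x -> is_derive x 1 F (expR (- (9 / 8) * log_gain x)).
  move=> x0; have h := is_derive_expR_log_gain (- (1 / 8)) x x0.
  have h2 : is_derive x 1 F
      (- 128 * (- (1 / 8) * (16 + x)^-1 * expR (- (1 / 8) * log_gain x))).
    by apply: is_derive_eq; rewrite /GRing.scale/= ?mulr1 ?mulr0 ?add0r ?addr0.
  apply: is_derive_eq h2 _.
  have -> : - (9 / 8) * log_gain x = - log_gain x + - (1 / 8) * log_gain x by field.
  rewrite expRD expRN lnK ?posrE; last by lra.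
  field; apply: lt0r_neq0; lra.
rewrite (@ge0_continuous_FTC2y _ _ F 0 0).
- by rewrite /F /log_gain mul0r addr0 ln1 mulr0 expR0 -EFinB; congr EFin; lra.
- by move=> x _; exact: expR_ge0.
- apply: derivable_within_continuous => x; rewrite in_itv/= andbT => x0.
  have x16 : -16 < x by lra.
  by have [] := is_derive_expR_log_gain (- (9 / 8)) x x16.
- rewrite -[X in _ --> X](mulr0 (- 128)); apply: cvgM; first exact: cvg_cst.
  under eq_fun do rewrite mulNr.
  have := @cvgr_expR R; apply: cvg_comp.
  by apply: (@gt0_cvgMry _ _ _ (1 / 8) _ _ (log_gain_cvgy R)); lra.
- by move=> x x0; have [] // := dF x; lra.
- apply: cvg_at_right_filter; apply: differentiable_continuous.
  by apply/derivable1_diffP; have [] // := dF 0; lra.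
- move=> x; rewrite in_itv/= andbT => x0; rewrite derive1E.
  by have [] // := dF x; lra.
Qed.

(** Since 56/11 < 5.14 and 56 = 8 * 7, taking seventh roots leaves [2 <= (e^(1/11))^8]. This follows
    from [e^(1/11) >= 12/11] by three squarings with rounding down. *)
Lemma ln128_le (R : realType) : ln 128 <= 514 / 100 :> R.
Proof.
rewrite -ler_expR lnK ?posrE//.
have -> : 128 = 2 ^+ 7 :> R by rewrite -natrX.
apply: (@le_trans _ _ (expR (56%:R * (1 / 11)))); last by rewrite ler_expR; lra.
rewrite expRM_natl (exprM _ 8 7) (exprM _ 4 2) (exprM _ 2 2).
set a := expR _.
have a1 : 12 / 11 <= a by have := @expR_ge1Dx R (1 / 11); rewrite -/a; lra.
have a2 : 119 / 100 <= a ^+ 2 by nra.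
have a4 : 1416 / 1000 <= (a ^+ 2) ^+ 2 by move: (a ^+ 2) a2 => b; nra.
apply: lerXn2r; rewrite ?nnegrE ?sqr_ge0//.
by move: ((a ^+ 2) ^+ 2) a4 => b; nra.
Qed.

(** * Integration along the function *)

(* The integrand of the right-hand side, with [g] standing for [f' x]. *)
Definition slope_cost {R : realType} (g x : R) : R :=
  expR (g ^+ 2 / 2) / Num.sqrt (1 + g ^+ 2 / 2) * expR (- (x ^+ 2 / 2)).

Lemma slope_cost_ge0 {R : realType} (g x : R) : 0 <= slope_cost g x.
Proof. by rewrite /slope_cost mulr_ge0 ?divr_ge0 ?expR_ge0 ?sqrtr_ge0. Qed.

Lemma continuous_slope_cost {R : realType} (g : R -> R) :
  continuous g -> continuous (fun x => slope_cost (g x) x).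
Proof.
move=> cg x.
have c1 : g y ^+ 2 / 2 @[y --> x] --> g x ^+ 2 / 2.
  by apply: cvgMl; rewrite expr2; apply: cvgM; exact: cg.
have c2 : - (y ^+ 2 / 2) @[y --> x] --> - (x ^+ 2 / 2).
  by apply: cvgN; apply: cvgMl; rewrite expr2; apply: cvgM; exact: cvg_id.
apply: cvgM; last first.
  exact: (@cvg_comp _ _ _ (fun y => - (y ^+ 2 / 2)) expR _ _ _ c2 (@continuous_expR R _)).
apply: cvgM.
  exact: (@cvg_comp _ _ _ (fun y => g y ^+ 2 / 2) expR _ _ _ c1 (@continuous_expR R _)).
apply: cvgV.
  by rewrite gt_eqF// sqrtr_gt0; have := sqr_ge0 (g x); lra.
have c3 : (1 + g y ^+ 2 / 2) @[y --> x] --> 1 + g x ^+ 2 / 2 by apply: cvgD; [exact: cvg_cst|].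
exact: (@cvg_comp _ _ _ (fun y => 1 + g y ^+ 2 / 2) Num.sqrt _ _ _ c3 (@sqrt_continuous R _)).
Qed.

(** Integrate [speed_bound] over [0, b]: the left side is an exact derivative, and the nonnegative
    cost allows enlarging the domain to the half-line. Stating it for a pair [f], [g] lets it serve
    for a function and its negative. *)
Lemma growth_bound {R : realType} (f g : R -> R) (b : R) :
  continuous f -> continuous g -> f 0 = 0 ->
  (forall x : R, 0 < x -> is_derive x 1 f (g x)) -> 0 <= b ->
  ((f b - b ^+ 2 / 2 + 9 / 8 * log_gain b)%:E <=
    \int[@lebesgue_measure R]_(x in `[0%R, +oo[) (slope_cost (g x) x)%:E)%E.
Proof.
(* At [b = 0] the left side is 0; otherwise [0, b] is nondegenerate, as the fundamental theorem of
   calculus requires. *)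
move=> cf cg f0 df; rewrite le_eqVlt => /predU1P[<-|b0].
  rewrite f0 expr0n/= /log_gain !mul0r addr0 ln1 mulr0 subr0 addr0.
  by apply: integral_ge0 => x _; rewrite lee_fin slope_cost_ge0.
pose F x := f x - x ^+ 2 / 2 + 9 / 8 * log_gain x.
pose F' x := g x - x + 9 / 8 / (16 + x).
have dF (x : R) : 0 < x -> is_derive x 1 F (F' x).
  move=> x0; have hf := df x x0.
  have x16 : -16 < x by lra.
  have hl := is_derive_log_gain x x16.
  apply: is_derive_eq; rewrite /F' /GRing.scale/= ?mulr1 ?mulr0 ?add0r ?addr0.
  by field; apply: lt0r_neq0; lra.
have cF (x : R) : 0 <= x -> F y @[y --> x] --> F x.
  move=> x0.
  apply: cvgD.
    apply: cvgB; first exact: cf.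
    by apply: cvgMl; rewrite expr2; apply: cvgM; exact: cvg_id.
  apply: cvgMr; apply: differentiable_continuous; apply/derivable1_diffP.
  have x16 : -16 < x by lra.
  by have [] := is_derive_log_gain x x16.
have cF' (x : R) : 0 <= x -> F' y @[y --> x] --> F' x.
  move=> x0; apply: cvgD.
    by apply: cvgB; [exact: cg|exact: cvg_id].
  apply: cvgMr; apply: cvgV; first by apply: lt0r_neq0; lra.
  by apply: cvgD; [exact: cvg_cst|exact: cvg_id].
have wF' : {within `[0, b], continuous F'}.
  apply: continuous_in_subspaceT => x; rewrite inE/= in_itv/= => /andP[x0 _].
  exact: cF'.
have ccost := continuous_slope_cost _ cg.
have ftc : (\int[@lebesgue_measure R]_(x in `[0%R, b]) (F' x)%:E = (F b)%:E - (F 0)%:E)%E.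
  apply: continuous_FTC2 => //.
  - split.
    + by move=> x; rewrite in_itv/= => /andP[x0 _]; have [] := dF _ x0.
    + by apply: cvg_at_right_filter; exact: cF.
    + by apply: cvg_at_left_filter; apply: cF; exact: ltW.
  - move=> x; rewrite in_itv/= => /andP[x0 _]; rewrite derive1E.
    by have [] := dF _ x0.
have F0 : F 0 = 0 by rewrite /F f0 expr0n/= /log_gain !mul0r addr0 ln1 mulr0 subr0 addr0.
move: ftc; rewrite F0 sube0 -/(F b) => <-.
apply: (@le_trans _ _ (\int[@lebesgue_measure R]_(x in `[0%R, b]) (slope_cost (g x) x)%:E)%E).
  apply: le_integral => //=.
  - by apply: continuous_compact_integrable => //; exact: segment_compact.
  - apply: continuous_compact_integrable; first exact: segment_compact.
    exact: continuous_subspaceT.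
  - by move=> x; rewrite inE/= in_itv/= => /andP[x0 _]; rewrite lee_fin; exact: speed_bound.
apply: ge0_subset_integral => //=.
- apply/measurable_EFinP; apply: measurable_funTS; exact: continuous_measurable_fun.
- by move=> x _; rewrite lee_fin slope_cost_ge0.
- by move=> x /=; rewrite !in_itv/= => /andP[->].
Qed.

(** * Conclusion: exponentiate the growth bound and integrate *)

Theorem theorem4p1 (R : realType) (f : R -> R)
  (f_smooth : smooth_in `[0, +oo[ f) (f0 : f 0 = 0) :
  (lne (\int[@lebesgue_measure R]_(x in `[0%R, +oo[)
          (expR `|f x| * expR (- (x ^+ 2 / 2)))%:E)
   <= \int[@lebesgue_measure R]_(x in `[0%R, +oo[)
          (expR (`|derive_in `[0%R, +oo[ f x| ^+ 2 / 2)
           / Num.sqrt (1 + `|derive_in `[0%R, +oo[ f x| ^+ 2 / 2)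
           * expR (- (x ^+ 2 / 2)))%:E
      + (514%:R / 100%:R)%:E)%E.
Proof.
(* On the negative axis [G] is frozen at the derivative at 0, so it is continuous everywhere, but it
   is claimed to be the derivative of [F] only for [x > 0]. *)
pose F (x : R) := f (Num.max x 0).
pose G (x : R) := derive_in `[0, +oo[ f (Num.max x 0).
have Dx (x : R) : 0 <= x -> `[0, +oo[%classic x by move=> x0; rewrite /= in_itv/= x0.
have cF : continuous F.
  apply: continuous_comp_max => x x0; apply: derivable_in_cvg; exact: (f_smooth 0%N x (Dx x x0)).
have cG : continuous G.
  apply: continuous_comp_max => x x0; apply: derivable_in_cvg; exact: (f_smooth 1%N x (Dx x x0)).
have dF (x : R) : 0 < x -> is_derive x 1 F (G x).
  move=> x0; rewrite /G max_l ?ltW//; apply: derivable_in_is_derive => //.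
  exact: (f_smooth 0%N x (Dx x (ltW x0))).
have F0 : F 0 = 0 by rewrite /F maxxx.
have -> : (\int[@lebesgue_measure R]_(x in `[0%R, +oo[)
          (expR (`|derive_in `[0%R, +oo[ f x| ^+ 2 / 2)
           / Num.sqrt (1 + `|derive_in `[0%R, +oo[ f x| ^+ 2 / 2)
           * expR (- (x ^+ 2 / 2)))%:E =
    \int[@lebesgue_measure R]_(x in `[0%R, +oo[) (slope_cost (G x) x)%:E)%E.
  apply: eq_integral => x; rewrite inE/= in_itv/= andbT => x0.
  by rewrite /slope_cost /G max_l// real_normK ?num_real.
have -> : (\int[@lebesgue_measure R]_(x in `[0%R, +oo[)
          (expR `|f x| * expR (- (x ^+ 2 / 2)))%:E =
    \int[@lebesgue_measure R]_(x in `[0%R, +oo[) (expR (`|F x| - x ^+ 2 / 2))%:E)%E.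
  apply: eq_integral => x; rewrite inE/= in_itv/= andbT => x0.
  by rewrite /F max_l// expRD.
have hp := growth_bound _ _ _ cF cG F0 dF.
(* The cost is even in the slope, so [- F] has the same right-hand integral as [F]. *)
have hm (b : R) : 0 <= b -> ((- F b - b ^+ 2 / 2 + 9 / 8 * log_gain b)%:E <=
    \int[@lebesgue_measure R]_(x in `[0%R, +oo[) (slope_cost (G x) x)%:E)%E.
  move=> b0.
  have -> : (\int[@lebesgue_measure R]_(x in `[0%R, +oo[) (slope_cost (G x) x)%:E =
    \int[@lebesgue_measure R]_(x in `[0%R, +oo[) (slope_cost (- G x) x)%:E)%E.
    by apply: eq_integral => x _; rewrite /slope_cost sqrrN.
  apply: (growth_bound (fun x => - F x) (fun x => - G x)) => //.
  - by move=> x; apply: cvgN; exact: cF.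
  - by move=> x; apply: cvgN; exact: cG.
  - by rewrite F0 oppr0.
  - by move=> x x0; have := dF x x0 => h; apply: is_deriveN.
have J0 : (0 <= \int[@lebesgue_measure R]_(x in `[0%R, +oo[) (slope_cost (G x) x)%:E)%E.
  by apply: integral_ge0 => x _; rewrite lee_fin slope_cost_ge0.
(* An infinite right-hand integral makes the claim trivial; nonnegativity rules out [-oo]. *)
move: J0 hp hm; case: (\int[_]_(x in _) (slope_cost _ _)%:E)%E => [j||]//; last first.
  by move=> _ _ _; rewrite addye// leey.
move=> j0 hp hm.
set I := (X in lne X).
have I0 : (0 <= I)%E by apply: integral_ge0 => x _; rewrite lee_fin expR_ge0.
have mE : measurable_fun (`[0, +oo[%classic : set R)
    (fun x : R => expR (- (9 / 8) * log_gain x)).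
  apply: subspace_continuous_measurable_fun => //.
  apply: derivable_within_continuous => x; rewrite in_itv/= andbT => x0.
  have x16 : -16 < x by lra.
  by have [] := is_derive_expR_log_gain (- (9 / 8)) x x16.
(* Together [hp] and [hm] bound [|F x| - x^2 / 2] by [j - 9/8 * log_gain x]; its exponential
   integrates to [128 e^j]. *)
have Ile : (I <= (expR j * 128)%:E)%E.
  rewrite EFinM -(integral_expR_log_gain R) -ge0_integralZl_EFin//=; first last.
    exact/measurable_EFinP.
  apply: ge0_le_integral => //=.
  - apply/measurable_EFinP; apply: measurable_funTS; apply: continuous_measurable_fun.
    move=> x; apply: (@cvg_comp _ _ _ (fun y => `|F y| - y ^+ 2 / 2) expR
      _ _ _ _ (@continuous_expR R _)).
    apply: cvgB; first by apply: cvg_norm; exact: cF.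
    by apply: cvgMl; rewrite expr2; apply: cvgM; exact: cvg_id.
  - by apply/measurable_EFinP; exact: measurable_funM.
  - move=> x; rewrite in_itv/= andbT => x0.
    rewrite -EFinM lee_fin -expRD ler_expR.
    have := hp x x0; have := hm x x0; rewrite !lee_fin.
    by case: (ger0P (F x)) => _; lra.
have e0 : 0 < expR j * 128 by rewrite mulr_gt0 ?expR_gt0.
apply: (@le_trans _ _ (lne (expR j * 128)%:E)).
  by rewrite lee_lne// in_itv/= ?leey ?andbT// lee_fin ltW.
rewrite lne_EFin// -EFinD lee_fin lnM ?posrE ?expR_gt0// expRK.
by rewrite lerD2l; exact: ln128_le R.
Qed.
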